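(* For any feedforward ReLU network with shared weights, the update $$p_i^{+}=p_i-\frac{\eta}{\kappa_i(p)}\frac{\partial L}{\partial p_i}(p),\qquad \kappa_i(p)=\frac12\frac{\partial^2\gamma_{\rm net}^2(p)}{\partial p_i^2},$$ is invariant to all feasible node-wise rescalings. Moreover, the simpler update rule that uses $$\kappa^{(1)}_i(p)=\sum_{e\in E_i}\ \sum_{\zeta\in\mathcal P:\ e\in\zeta}\ \prod_{e'\in\zeta,\ e'\ne e}p_{\pi(e')}^2$$ in place of $\kappa_i(p)$ is also invariant to all feasible node-wise rescalings.
   Context: A feedforward network with shared weights is given by a directed acyclic graph $G=(V,E)$ with input nodes $V_{\rm in}$ (no incoming edges) and output nodes $V_{\rm out}$ (no outgoing edges), the remaining nodes being internal; a parameter vector $p\in\mathbb R^{N}$; and a map $\pi:E\to\{1,\dots,N\}$, with edge weights $w_e=p_{\pi(e)}$ and $E_i=\pi^{-1}(i)$. It computes $f_p$: input nodes output the coordinates of the input, internal nodes output $h_v=\max(0,\sum_{(u\to v)\in E}w_{u\to v}h_u)$, and output nodes output $h_v=\sum_{(u\to v)\in E}w_{u\to v}h_u$. $\mathcal P$ is the set of directed paths from input nodes to output nodes, each identified with its sequence of edges, and $\gamma^2_{\rm net}(p)=\sum_{\zeta\in\mathcal P}\prod_{e\in\zeta}p_{\pi(e)}^2$. $L(p)$ is a training loss depending on $p$ only through the function $f_p$; $\eta>0$ is the step size; the update is considered at points $p$ where $L$ is differentiable and the $\kappa_i(p)$ (resp. $\kappa_i^{(1)}(p)$) are nonzero. A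 node-wise rescaling is a map $\mathcal T$ on edge weights $w_{u\to v}\mapsto(\beta_v/\beta_u)w_{u\to v}$ with $\beta_v>0$ for internal nodes and $\beta_v=1$ for input and output nodes; it is feasible if shared weights remain equal after it (for every $p$ and every $i$, all edges in $E_i$ have equal transformed weights), so it induces a map $p\mapsto\mathcal T(p)$. An update rule $\mathcal A$ is invariant to $\mathcal T$ if $f_{\mathcal A(p)}=f_{\mathcal A(\mathcal T(p))}$ for every $p$ at which the update is defined. *)

(* Defs.v *)
From HB Require Import structures.
From mathcomp Require Import all_boot all_order all_algebra.
From mathcomp Require Import all_classical all_reals all_analysis.
Import Order.TTheory GRing.Theory Num.Theory numFieldNormedType.Exports.

Set Implicit Arguments.
Unset Strict Implicit.
Unset Printing Implicit Defensive.

Local Open Scope ring_scope.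

(* [(u, v) \in edges] is the edge u -> v. The map [share] (pi) sends an edge
   to the index of the parameter that it carries. *)
Record network (V : finType) (N : nat) := Network {
  edges : {set V * V};
  inputs : {set V};
  outputs : {set V};
  share : {e : V * V | e \in edges} -> 'I_N;
  edges_acyclic : forall c : seq V, cycle [rel u v | (u, v) \in edges] c ->
    c = [::];
  inputs_source : forall u v, (u, v) \in edges -> v \notin inputs;
  outputs_sink : forall u v, (u, v) \in edges -> u \notin outputs }.

Section Network.
Variables (R : realType) (V : finType) (N : nat) (G : network V N).

Definition edge := {e : V * V | e \in edges G}.
Definition src (e : edge) : V := (val e).1.
Definition tgt (e : edge) : V := (val e).2.

Definition input_node := {v : V | v \in inputs G}.
Definition output_node := {v : V | v \in outputs G}.

Definition internal (v : V) : bool := (v \notin inputs G) && (v \notin outputs G).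

Definition weights (p : 'rV[R]_N) (e : edge) : R := p 0 (share e).

Definition node_rule (w : edge -> R) (x : input_node -> R) (h : V -> R)
    (v : V) : R :=
  if insub v is Some u then x u else
  let s := \sum_(e : edge | tgt e == v) w e * h (src e) in
  if v \in outputs G then s else Num.max 0 s.

(* As the graph is acyclic, #|V| rounds of [node_rule] reach its unique fixed
   point, whatever the initial values; see [node_value_rec]. *)
Definition node_value (w : edge -> R) (x : input_node -> R) : V -> R :=
  iter #|V| (node_rule w x) (fun=> 0).

Definition net_fun (p : 'rV[R]_N) (x : input_node -> R) (v : output_node) : R :=
  node_value (weights p) x (val v).

Fixpoint walk (u : V) (z : seq edge) (v : V) : bool :=
  if z is e :: z' then (src e == u) && walk (tgt e) z' v else u == v.

Definition io_path (z : seq edge) : bool :=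
  [exists u in inputs G, exists v in outputs G, walk u z v].

(* The length bound makes this a finite set; by [io_path_size] it excludes no
   input-output path. *)
Definition io_paths : {set #|{: edge}|.-bseq edge} :=
  [set z : #|{: edge}|.-bseq edge | io_path z].

Definition path_norm2 (p : 'rV[R]_N) : R :=
  \sum_(z in io_paths) \prod_(e <- z) (p 0 (share e)) ^+ 2.

Definition kappa (i : 'I_N) (p : 'rV[R]_N) : R :=
  2^-1 * 'D_'e_i ('D_'e_i path_norm2) p.

Definition kappa1 (i : 'I_N) (p : 'rV[R]_N) : R :=
  \sum_(e : edge | share e == i) \sum_(z in io_paths | e \in z)
     \prod_(e' <- z | e' != e) (p 0 (share e')) ^+ 2.

Definition update (k : 'I_N -> 'rV[R]_N -> R) (L : 'rV[R]_N -> R) (eta : R)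
    (p : 'rV[R]_N) : 'rV[R]_N :=
  \row_i (p 0 i - eta / k i p * 'D_'e_i L p).

Definition update_defined (k : 'I_N -> 'rV[R]_N -> R) (L : 'rV[R]_N -> R)
    (p : 'rV[R]_N) : Prop :=
  differentiable L p /\ forall i, k i p != 0.

Definition node_rescaling (beta : V -> R) : Prop :=
  (forall v, internal v -> 0 < beta v) /\ (forall v, ~~ internal v -> beta v = 1).

Definition rescale (beta : V -> R) (w : edge -> R) (e : edge) : R :=
  beta (tgt e) / beta (src e) * w e.

Definition feasible (beta : V -> R) : Prop :=
  forall (p : 'rV[R]_N) (i : 'I_N) (e e' : edge), share e = i -> share e' = i ->
    rescale beta (weights p) e = rescale beta (weights p) e'.

(* A parameter carried by no edge is left unchanged. *)
Definition rescale_param (beta : V -> R) (p : 'rV[R]_N) : 'rV[R]_N :=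
  \row_i (if [pick e : edge | share e == i] is Some e
          then rescale beta (weights p) e else p 0 i).

(* The update rule is the partial map given by [A] on the domain [D]: the
   image of a point of [D] under [T] must be in [D] too. *)
Definition invariant_to (D : 'rV[R]_N -> Prop) (A T : 'rV[R]_N -> 'rV[R]_N) :
    Prop :=
  forall p, D p -> D (T p) /\ net_fun (A p) = net_fun (A (T p)).

Lemma weights_rescale_param beta p e : feasible beta ->
  weights (rescale_param beta p) e = rescale beta (weights p) e.
Proof.
move=> fb; rewrite /weights mxE; case: pickP => [e' /eqP e'e|/(_ e)].
  exact: (fb p (share e)).
by rewrite eqxx.
Qed.

Let link : rel V := [rel u v | (u, v) \in edges G].

Lemma link_uniq u s : path link u s -> uniq (u :: s).
Proof.
elim: s u => [//|v s IHs] u /= /andP[uv vs].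
have := IHs _ vs; rewrite /= => ->; rewrite andbT.
apply/negP => us.
have pus : path link u (v :: s) by rewrite /= uv.
case/path.splitP: us pus => p1 p2; rewrite cat_path => /andP[cp _].
by have := @edges_acyclic _ _ G (u :: p1) cp.
Qed.

Lemma io_path_size z : io_path z -> (size z <= #|{: edge}|)%N.
Proof.
case/exists_inP => u _ /exists_inP[v _ wz].
suff /link_uniq /= /andP[_ /map_uniq uz] : path link u (map tgt z).
  by rewrite -(card_uniqP uz) max_card.
elim: z u wz => //= e z IHz u /andP[/eqP <- /IHz ->].
by rewrite andbT /link /= /src /tgt -surjective_pairing (valP e).
Qed.

Lemma node_value_rec w x v : node_rule w x (node_value w x) v = node_value w x v.
Proof.
suff H k u : iter k.+1 (node_rule w x) (fun=> 0) u !=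
       iter k (node_rule w x) (fun=> 0) u ->
    exists t s, [/\ path link t s, last t s = u & size s = k].
  apply/eqP/negPn/negP => /(H #|V|)[t [s [/link_uniq us _ ss]]].
  have : (size (t :: s) <= #|V|)%N by rewrite -(card_uniqP us) max_card.
  by rewrite /= ss ltnn.
elim: k u => [|k IHk] u; first by exists u, [::].
set h0 := iter k (node_rule w x) (fun=> 0) in IHk *.
rewrite -[iter k.+1 _ _]/(node_rule w x h0) in IHk *.
rewrite -[iter k.+2 _ _]/(node_rule w x (node_rule w x h0)).
set h1 := node_rule w x h0 in IHk *.
rewrite [node_rule w x h1 u]/node_rule [h1 u]/h1 {1}/node_rule.
case: insubP => [?|_]; first by rewrite eqxx.
have [[e /eqP <- ne] _|nex] :=
    pselect (exists2 e : edge, tgt e == u & h1 (src e) != h0 (src e)).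
  have [t [s [ps ls ss]]] := IHk _ ne.
  exists t, (rcons s (tgt e)); rewrite rcons_path last_rcons size_rcons ss ps ls.
  by split=> //; rewrite /link /= /src /tgt -surjective_pairing (valP e).
rewrite (eq_bigr (fun e => w e * h0 (src e))).
  by rewrite eqxx.
move=> e eu; congr (_ * _); apply/eqP/negPn/negP => ne.
by apply: nex; exists e.
Qed.

End Network.

Arguments net_fun {R V N} G p x v.

(* Main.v *)
(* A feasible node-wise rescaling acts on the parameters by a diagonal matrix
   with positive entries [c_i]. It preserves the network function (positive
   homogeneity of the ReLU), hence [L], and it preserves the path norm (the
   rescaling factors telescope along an input-output path). By the chain rule
   the i-th partial derivative at [T p] is [c_i^-1] times the one at [p], so
   [kappa_i] picks up [c_i^-2]; so does [kappa1_i], as a path runs through an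
   edge at most once and its full product is preserved. The step then picks up
   [c_i^2 * c_i^-1 = c_i], that is, the update commutes with [T]. *)
Require Import Defs.
From HB Require Import structures.
From mathcomp Require Import all_boot all_order all_algebra.
From mathcomp Require Import all_classical all_reals all_analysis.
Import Order.TTheory GRing.Theory Num.Theory numFieldNormedType.Exports.

Set Implicit Arguments.
Unset Strict Implicit.

Local Open Scope ring_scope.
Local Open Scope classical_set_scope.

(** Justifies the substitution [h -> k * h] in a difference quotient. An equality of filters, not
    mere convergence, makes the two [lim] agree even when no limit exists. *)
Lemma mull_dnbhs0 (R : realType) (k : R) : k != 0 ->
  (fun h : R => k * h) @ 0^' = 0^'.
Proof.
have sub (a : R) : a != 0 -> (fun h : R => a * h) @ 0^' --> 0^'.
  move=> a0 A /nbhs_ballP[e /= e0 eA]; apply/nbhs_ballP.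
  exists (e / `|a|) => /=; first by rewrite divr_gt0 ?normr_gt0.
  move=> h; rewrite /ball/= !sub0r !normrN => hlt h0; apply: eA.
    by rewrite /ball/= sub0r normrN normrM mulrC -ltr_pdivlMr ?normr_gt0.
  by rewrite mulf_neq0.
move=> k0; apply/seteqP; split=> A; last exact: sub.
move=> kA; have kV0 : k^-1 != 0 by rewrite invr_eq0.
rewrite (_ : A = [set h | A (k * (k^-1 * h))]); first exact: sub _ kV0 _ kA.
by apply/funext => h /=; rewrite mulVKf.
Qed.

Lemma lim_mull (R : realType) (F : set_system R) (a : R) (f : R -> R) :
  ProperFilter F -> a != 0 ->
  lim ((fun x => a * f x) @ F) = a * lim (f @ F).
Proof.
move=> FF a0; have [cf|ncf] := pselect (cvg (f @ F)).
  apply: cvg_lim; first exact: Rhausdorff.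
  by apply: cvgM => //; exact: cvg_cst.
(* [lim] of a divergent filter is the junk value [point], here [0]. *)
rewrite (dvgP ncf) dvgP; first by rewrite mulr0.
move=> caf; apply: ncf.
rewrite (_ : f = fun x => a^-1 * (a * f x)); first exact: is_cvgM (is_cvg_cst _) caf.
by apply/funext => x; rewrite mulKf.
Qed.

Definition coord_scale {R : realType} {N : nat} (c : 'I_N -> R)
  (p : 'rV[R]_N) : 'rV[R]_N := \row_j (c j * p 0 j).

Section CoordScale.
Variables (R : realType) (N : nat) (c : 'I_N -> R).
Hypothesis c_neq0 : forall j, c j != 0.
Implicit Types (p : 'rV[R]_N) (f : 'rV[R]_N -> R).

Lemma coord_scaleVK p : coord_scale c (coord_scale (fun j => (c j)^-1) p) = p.
Proof. by apply/rowP => j; rewrite !mxE mulVKf. Qed.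

Lemma coord_scaleKV p : coord_scale (fun j => (c j)^-1) (coord_scale c p) = p.
Proof. by apply/rowP => j; rewrite !mxE mulKf. Qed.

Lemma differentiable_coord_scale d p : differentiable (@coord_scale R N d) p.
Proof.
rewrite (_ : coord_scale d =
    \sum_(j < N) fun q : 'rV[R]_N => (d j * q 0 j) *: 'e_j); last first.
  apply/funext => q; rewrite fct_sumE [LHS]row_sum_delta.
  by apply: eq_bigr => j _; rewrite mxE.
apply: differentiable_sum => j; apply: differentiableZl.
by apply: differentiableM => //; exact: differentiable_coord.
Qed.

(** Invariance makes [f] its own composite with the inverse scaling, which sends [coord_scale c p]
    back to [p]; the chain rule applies. *)
Lemma differentiable_coord_scale_inv f p :
  (forall q, f (coord_scale c q) = f q) ->
  differentiable f p -> differentiable f (coord_scale c p).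
Proof.
move=> fc df.
rewrite (_ : f = f \o coord_scale (fun j => (c j)^-1)); last first.
  by apply/funext => q; rewrite -[RHS]fc coord_scaleVK.
apply: differentiable_comp; first exact: differentiable_coord_scale.
by rewrite coord_scaleKV.
Qed.

(* The two difference quotients are proportional: either both converge, or both
   limits are the junk value [0]. *)
Lemma derive_coord_scale f (a : R) i p : a != 0 ->
  (forall q, f (coord_scale c q) = a * f q) ->
  'D_'e_i f (coord_scale c p) = a / c i * 'D_'e_i f p.
Proof.
move=> a0 fc.
pose Q (h : R) : R := h^-1 * (f (h *: 'e_i + p) - f p).
transitivity (lim ((fun h => a / c i * Q ((c i)^-1 * h)) @ 0^')); last first.
  rewrite -[RHS]/(a / c i * lim (Q @ 0^')).
  rewrite -[in RHS](@mull_dnbhs0 R (c i)^-1) ?invr_eq0//.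
  by apply: lim_mull; rewrite mulf_neq0 ?invr_eq0.
apply: (congr1 (fun g : R -> R => lim (g @ 0^'))).
apply/funext => h /=; rewrite {}/Q fc.
(* A step [h] along ['e_i] from the scaled point is the image of a step [h / c i] from [p]. *)
have -> : h *: 'e_i + coord_scale c p = coord_scale c (((c i)^-1 * h) *: 'e_i + p).
  apply/rowP => j; rewrite !mxE eqxx /= mulrDr.
  by have [->|_] := eqVneq; rewrite ?mulr1 ?mulr0 ?mulVKf.
rewrite fc -mulrBr /GRing.scale /= invfM invrK.
rewrite -!mulrA (mulrCA _ a); congr (_ * _).
by rewrite mulKf.
Qed.

End CoordScale.

Section Rescaling.
Variables (R : realType) (V : finType) (N : nat) (G : network V N).
Variable beta : V -> R.
Hypotheses (beta_resc : node_rescaling G beta) (beta_feas : feasible G beta).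

Lemma node_rescaling_gt0 v : 0 < beta v.
Proof.
by case: beta_resc => bp b1; case: (boolP (internal G v)) => [/bp|/b1 ->].
Qed.

Lemma node_rescaling_neq0 v : beta v != 0.
Proof. by rewrite gt_eqF ?node_rescaling_gt0. Qed.

Lemma node_rescaling_input v : v \in inputs G -> beta v = 1.
Proof. by case: beta_resc => _ b1 vi; apply: b1; rewrite /internal vi. Qed.

Lemma node_rescaling_output v : v \in outputs G -> beta v = 1.
Proof. by case: beta_resc => _ b1 vo; apply: b1; rewrite /internal vo andbF. Qed.

(** The diagonal entry [c_i]; by feasibility the choice of edge does not matter. The default [1]
    agrees with [rescale_param] on parameters carried by no edge. *)
Definition rescale_coef (i : 'I_N) : R :=
  if [pick e : edge G | share e == i] is Some e
  then beta (tgt e) / beta (src e) else 1.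

Lemma rescale_coef_gt0 i : 0 < rescale_coef i.
Proof.
by rewrite /rescale_coef; case: pickP => // e _; rewrite divr_gt0 ?node_rescaling_gt0.
Qed.

Lemma rescale_coef_neq0 i : rescale_coef i != 0.
Proof. by rewrite gt_eqF ?rescale_coef_gt0. Qed.

Lemma rescale_coef_share (e : edge G) :
  rescale_coef (share e) = beta (tgt e) / beta (src e).
Proof.
rewrite /rescale_coef; case: pickP => [e' /eqP e'e|/(_ e)]; last by rewrite eqxx.
(* With all parameters equal to [1], feasibility compares the bare factors. *)
have := beta_feas (const_mx 1) e'e erefl.
by rewrite /rescale /weights !mxE !mulr1.
Qed.

Lemma rescale_paramE : rescale_param G beta = coord_scale rescale_coef.
Proof.
apply/funext => p; apply/rowP => i; rewrite !mxE /rescale_coef.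
by case: pickP => [e /eqP <- //|_]; rewrite mul1r.
Qed.

(** Induction on the number of rounds: [beta (src e)] cancels in each summand, and [beta v > 0]
    comes out of the sum and of the [max]. *)
Lemma iter_node_rule_rescale (w : edge G -> R) x k v :
  iter k (node_rule (rescale beta w) x) (fun=> 0) v =
  beta v * iter k (node_rule w x) (fun=> 0) v.
Proof.
elim: k v => [|k IHk] v; first by rewrite mulr0.
rewrite !iterS {1 3}/node_rule.
case: insubP => [u vi uv|_]; first by rewrite (node_rescaling_input vi) mul1r.
rewrite (_ : \sum_(e : edge G | tgt e == v) _ = beta v *
    \sum_(e : edge G | tgt e == v) w e * iter k (node_rule w x) (fun=> 0) (src e)).
  case: ifP => // _.
  by rewrite maxr_pMr ?mulr0 // ltW // node_rescaling_gt0.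
rewrite mulr_sumr; apply: eq_bigr => e /eqP <-; rewrite IHk /rescale.
by rewrite mulrACA divfK ?node_rescaling_neq0 // mulrA.
Qed.

Lemma net_fun_rescale (p : 'rV[R]_N) :
  net_fun G (coord_scale rescale_coef p) = net_fun G p.
Proof.
apply/funext => x; apply/funext => v; rewrite /net_fun /node_value.
rewrite -rescale_paramE (_ : weights _ = rescale beta (weights p)); last first.
  by apply/funext => e; exact: weights_rescale_param.
by rewrite iter_node_rule_rescale node_rescaling_output ?mul1r // (valP v).
Qed.

Lemma walk_prod u (z : seq (edge G)) v : walk u z v ->
  \prod_(e <- z) rescale_coef (share e) = beta v / beta u.
Proof.
elim: z u => [|e z IHz] u /=.
  by move=> /eqP ->; rewrite big_nil divff ?node_rescaling_neq0.
move=> /andP[/eqP <- /IHz zv]; rewrite big_cons zv rescale_coef_share.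
by rewrite mulrC mulrA divfK ?node_rescaling_neq0.
Qed.

Lemma io_path_prod (z : seq (edge G)) : io_path z ->
  \prod_(e <- z) rescale_coef (share e) = 1.
Proof.
case/exists_inP => u ui /exists_inP[v vo /walk_prod ->].
by rewrite (node_rescaling_input ui) (node_rescaling_output vo) divr1.
Qed.

(** By acyclicity the targets of the edges along a walk are distinct, hence so are the edges. *)
Lemma io_path_uniq (z : seq (edge G)) : io_path z -> uniq z.
Proof.
case/exists_inP => u _ /exists_inP[v _ wz].
suff /link_uniq /= /andP[_ /map_uniq] :
    path [rel u v | (u, v) \in edges G] u (map (@tgt V N G) z) by [].
elim: z u wz => //= e z IHz u /andP[/eqP <- /IHz ->].
by rewrite andbT /src /tgt -surjective_pairing (valP e).
Qed.

Lemma path_norm2_rescale (p : 'rV[R]_N) :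
  path_norm2 G (coord_scale rescale_coef p) = path_norm2 G p.
Proof.
apply: eq_bigr => z; rewrite inE => /io_path_prod z1.
under eq_bigr do rewrite mxE exprMn.
by rewrite big_split /= prodrXl z1 expr1n mul1r.
Qed.

(** [derive_coord_scale] is used twice: with [a = 1] on the path norm, then with [a = c_i^-1] on its
    partial derivative, which is only invariant up to that factor. *)
Lemma kappa_rescale i (p : 'rV[R]_N) :
  kappa G i (coord_scale rescale_coef p) = (rescale_coef i)^-2 * kappa G i p.
Proof.
have c0 := rescale_coef_neq0.
rewrite /kappa (@derive_coord_scale _ _ _ c0 _ (rescale_coef i)^-1) ?invr_eq0 //.
  by rewrite mulrCA -invfM -expr2.
move=> q; rewrite (@derive_coord_scale _ _ _ c0 _ 1) ?oner_eq0 ?mul1r // => r.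
by rewrite mul1r path_norm2_rescale.
Qed.

Lemma kappa1_rescale i (p : 'rV[R]_N) :
  kappa1 G i (coord_scale rescale_coef p) = (rescale_coef i)^-2 * kappa1 G i p.
Proof.
rewrite /kappa1 mulr_sumr; apply: eq_bigr => e /eqP ei.
rewrite mulr_sumr; apply: eq_bigr => z; rewrite inE => /andP[zio ez].
under eq_bigr do rewrite mxE exprMn.
rewrite big_split /= prodrXl; congr (_ * _).
(* As [e] occurs once in [z], the product of the other factors is [c_i^-1]. *)
have := io_path_prod zio; rewrite (bigD1_seq e) ?io_path_uniq //= ei => cz.
by rewrite -[LHS](mulKf (expf_neq0 2 (rescale_coef_neq0 i))) -exprMn cz expr1n mulr1.
Qed.

(** Kept abstract in [k]: the [c_i^-2] law is all that the two choices of [kappa] need to share. *)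
Lemma update_invariant (L : 'rV[R]_N -> R) (eta : R)
    (k : 'I_N -> 'rV[R]_N -> R) :
  (forall p q, net_fun G p = net_fun G q -> L p = L q) ->
  (forall i p, k i (coord_scale rescale_coef p) = (rescale_coef i)^-2 * k i p) ->
  invariant_to G (update_defined k L) (update k L eta) (rescale_param G beta).
Proof.
move=> L_net kc p [dL k0]; rewrite rescale_paramE.
have c0 := rescale_coef_neq0.
have Lc q : L (coord_scale rescale_coef q) = L q.
  by apply: L_net; exact: net_fun_rescale.
split.
  split; first exact: differentiable_coord_scale_inv.
  by move=> i; rewrite kc mulf_neq0 ?invr_eq0 ?expf_neq0.
(* Rescaling the updated point on the left leaves its function unchanged and reduces the goal to
   commutation of the update with the rescaling. *)
rewrite -[LHS]net_fun_rescale; congr (net_fun G); apply/rowP => i.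
rewrite !mxE kc (@derive_coord_scale _ _ _ c0 _ 1) ?oner_eq0 //; last first.
  by move=> q; rewrite mul1r.
rewrite mulrBr; congr (_ - _).
rewrite div1r invfM invrK expr2 -!mulrA [LHS]mulrCA; congr (_ * (_ * _)).
by rewrite (mulrCA (k i p)^-1) mulVKf.
Qed.

End Rescaling.

Theorem theorem35 (R : realType) (V : finType) (N : nat) (G : network V N)
    (L : 'rV[R]_N -> R)
    (L_net : forall p q : 'rV[R]_N, net_fun G p = net_fun G q -> L p = L q)
    (eta : R) (eta_gt0 : 0 < eta) :
  (forall beta : V -> R, node_rescaling G beta -> feasible G beta ->
     invariant_to G (update_defined (kappa G) L) (update (kappa G) L eta)
       (rescale_param G beta)) /\
  (forall beta : V -> R, node_rescaling G beta -> feasible G beta ->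
     invariant_to G (update_defined (kappa1 G) L) (update (kappa1 G) L eta)
       (rescale_param G beta)).
Proof.
split=> beta beta_resc beta_feas; apply: update_invariant => // i p.
  exact: kappa_rescale.
exact: kappa1_rescale.
Qed.
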